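(* If a graph $G$ is $12$-representable by a $132$-avoiding word, then $G$ is a co-interval graph.
   Context: All graphs are finite, simple and undirected. Let $[n]=\{1,\ldots,n\}$. For a word $w$ over positive integers, $\mathrm{red}(w)$ is the word obtained from $w$ by replacing each occurrence of the $i$th smallest letter with $i$. For a word (pattern) $p=p_1\cdots p_k$ with $\mathrm{red}(p)=p$, a word $w=w_1\cdots w_\ell$ contains $p$ if there are indices $i_1<\cdots<i_k$ with $\mathrm{red}(w_{i_1}\cdots w_{i_k})=p$; otherwise $w$ avoids $p$ (is $p$-avoiding). A labeled graph with vertex set $[n]$ is $12$-represented by a word $w$ over $[n]$ containing at least one copy of each letter of $[n]$ if for all $i<j$ in $[n]$: $i$ and $j$ are adjacent if and only if every occurrence of $j$ precedes every occurrence of $i$ in $w$. An (unlabeled) graph on $n$ vertices is $12$-representable by a $p$-avoiding word if its vertices can be labeled bijectively by $[n]$ so that the resulting labeled graph is $12$-represented by some $p$-avoiding word. A co-interval graph is the complement of an interval graph, where an interval graph is the intersection graph of intervals on the real line. *)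

(* Defs.v *)
From mathcomp Require Import all_boot all_order all_algebra.
From mathcomp Require Import reals.

Set Implicit Arguments.
Unset Strict Implicit.
Unset Printing Implicit Defensive.

Record sgraph (V : finType) := SGraph {
  adj : rel V;
  adj_sym : symmetric adj;
  adj_irrefl : irreflexive adj
}.

Definition compl_adj (V : finType) (G : sgraph V) : rel V :=
  fun u v => (u != v) && ~~ adj G u v.

Lemma compl_adj_sym (V : finType) (G : sgraph V) : symmetric (compl_adj G).
Proof. by move=> u v; rewrite /compl_adj eq_sym (adj_sym G). Qed.

Lemma compl_adj_irrefl (V : finType) (G : sgraph V) :
  irreflexive (compl_adj G).
Proof. by move=> u; rewrite /compl_adj eqxx. Qed.

Definition compl_graph (V : finType) (G : sgraph V) : sgraph V :=
  SGraph (compl_adj_sym G) (compl_adj_irrefl G).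

(* The intervals are nonempty, with no condition on their endpoints: open,
   closed, half-open, degenerate and unbounded ones are all allowed. *)
Definition interval_graph (R : realType) (V : finType) (G : sgraph V) : Prop :=
  exists I : V -> interval R,
    (forall v, exists x : R, x \in I v) /\
    (forall u v, u != v ->
       (adj G u v <-> exists x : R, x \in I u /\ x \in I v)).

Definition co_interval_graph (R : realType) (V : finType) (G : sgraph V) :
  Prop := interval_graph R (compl_graph G).

Definition red (w : seq nat) : seq nat :=
  [seq (index x (sort leq (undup w))).+1 | x <- w].

Definition contains (p w : seq nat) : Prop :=
  exists s : seq nat, subseq s w /\ red s = p.

Definition avoids (p w : seq nat) : Prop := ~ contains p w.

Definition all_precede (w : seq nat) (y x : nat) : Prop :=
  forall a b : nat, a < size w -> b < size w ->
    nth 0 w a = y -> nth 0 w b = x -> a < b.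

(* The vertex set {1, ..., n} is encoded as 'I_n, where i : 'I_n stands for
   the letter i.+1; words are over the letters 1, ..., n themselves. *)
Definition represents12 (n : nat) (L : sgraph 'I_n) (w : seq nat) : Prop :=
  (forall x : nat, (x \in w) = (1 <= x <= n)) /\
  (forall i j : 'I_n, i < j -> (adj L i j <-> all_precede w j.+1 i.+1)).

Definition representable12_avoiding (p : seq nat) (V : finType)
    (G : sgraph V) : Prop :=
  exists (lab : V -> 'I_#|V|) (L : sgraph 'I_#|V|) (w : seq nat),
    [/\ bijective lab,
        forall u v, adj L (lab u) (lab v) = adj G u v,
        represents12 L w
      & avoids p w].

(* Main.v *)
Require Import Defs.
From mathcomp Require Import all_boot all_order all_algebra.
From mathcomp Require Import reals.
From mathcomp Require Import zify.

(** Orient every edge of the labeled graph from its larger label [a] to its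
    smaller label [b], and write [a -> b]; thus [a -> b] means that [b < a] and
    that all copies of [a] precede all copies of [b].  Suppose that [a -> b] and
    [c -> d], but neither [a -> d] nor [c -> b].  Comparing labels alone
    excludes [a <= d] together with [c <= b], and comparing positions alone
    excludes that a [d] precedes an [a] while a [b] precedes a [c].  So, up to
    exchanging the two edges, [b < a <= d < c] and some [b] precedes some [c];
    as all copies of [c] precede those of [d], the letters [b c d] form a copy
    of 132 ([orientation_two_plus_two_free]).

    Hence in the 132-avoiding case the orientation is an irreflexive relation
    without 2 + 2, that is, an interval order, and the non-edges of the graph
    are its incomparable pairs.  By Fishburn's theorem, whose finite case is
    [interval_graph_of_two_plus_two_free], these form an interval graph. *)

Set Implicit Arguments.
Unset Strict Implicit.
Unset Printing Implicit Defensive.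

Import Order.TTheory Num.Theory.

Section IntervalOrder.

Variables (V : finType) (lt : rel V).

Definition downset (v : V) : {set V} := [set x | lt x v].

(** The right endpoint of [u] in the canonical representation, whose left
    endpoints are the sizes of the down-sets: it has to reach the left endpoint of
    every element that is not above [u]. *)
Definition reach (u : V) : nat := \max_(w | ~~ lt u w) #|downset w|.

Hypothesis lt_irrefl : irreflexive lt.
Hypothesis lt_22free :
  forall a b c d, lt a b -> lt c d -> lt a d || lt c b.

(** Absence of 2 + 2 makes the down-sets a chain under inclusion, so that one
    missing an element of another is properly contained in it. *)
Lemma downset_card_lt u v w :
  lt u v -> ~~ lt u w -> #|downset w| < #|downset v|.
Proof.
move=> uv nuw; apply/proper_card/properP; split; last first.
  by exists u; rewrite !inE.
apply/subsetP => x; rewrite !inE => xw.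
by have := lt_22free uv xw; rewrite (negbTE nuw).
Qed.

Lemma card_downset_le_reach u : #|downset u| <= reach u.
Proof. by apply: leq_bigmax_cond; rewrite lt_irrefl. Qed.

Lemma reach_lt u v : (reach u < #|downset v|) = lt u v.
Proof.
apply/idP/idP => [|uv].
  by apply: contraTT => nuv; rewrite -leqNgt; apply: leq_bigmax_cond.
have v_gt0 : 0 < #|downset v| by apply/card_gt0P; exists u; rewrite inE.
rewrite -(prednK v_gt0) ltnS; apply/bigmax_leqP => w nuw.
by rewrite -ltnS (prednK v_gt0) (downset_card_lt uv nuw).
Qed.

(** The closed intervals from [#|downset v|] to [reach v] represent the
    incomparability graph: two of them are disjoint exactly when one ends before
    the other begins, which by [reach_lt] is comparability. *)
Lemma interval_graph_of_two_plus_two_free (R : realType) (G : sgraph V) :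
  (forall u v, u != v -> adj G u v = ~~ lt u v && ~~ lt v u) ->
  interval_graph R G.
Proof.
move=> adjE.
exists (fun v => `[(#|downset v|%:R : R)%R, (reach v)%:R%R]%R).
split=> [v|u v neq_uv].
  by exists (#|downset v|%:R)%R; rewrite in_itv /= lexx ler_nat
    card_downset_le_reach.
rewrite adjE // -!reach_lt -!leqNgt; split=> [/andP[vu uv]|[x []]].
  exists (maxn #|downset u| #|downset v|)%:R%R.
  rewrite !in_itv /= !ler_nat leq_maxl leq_maxr !geq_max.
  by rewrite !card_downset_le_reach vu uv.
rewrite !in_itv /= => /andP[ux xu] /andP[vx xv].
by rewrite -!(ler_nat R) (le_trans vx xu) (le_trans ux xv).
Qed.

End IntervalOrder.

Lemma subseq_nth (T : eqType) (x0 : T) (s : seq T) (ps : seq nat) :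
  sorted ltn ps -> all (gtn (size s)) ps ->
  subseq [seq nth x0 s i | i <- ps] s.
Proof.
move=> ps_sorted /allP ps_lt.
rewrite -{2}(mkseq_nth x0 s); apply: map_subseq.
suff -> : ps = [seq i <- iota 0 (size s) | i \in ps] by apply: filter_subseq.
apply: (irr_sorted_eq ltn_trans ltnn ps_sorted).
  exact: (sorted_filter ltn_trans _ (iota_ltn_sorted _ _)).
move=> i; rewrite mem_filter mem_iota add0n /=.
by case: (boolP (i \in ps)) => // /ps_lt.
Qed.

Lemma red_132 x y z : x < z -> z < y -> red [:: x; y; z] = [:: 1; 3; 2].
Proof.
move=> xz zy; rewrite /red.
have [nxz [nzy nxy]] : x != z /\ z != y /\ x != y by lia.
have uniq_xyz : uniq [:: x; y; z].
  by rewrite /= !inE negb_or nxy nxz eq_sym nzy.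
rewrite undup_id //.
have -> : sort leq [:: x; y; z] = [:: x; z; y].
  apply: (sorted_eq leq_trans anti_leq).
  - exact/sort_sorted/leq_total.
  - by rewrite /= (ltnW xz) (ltnW zy).
  - rewrite perm_sort perm_cons.
    exact/permPl/(perm_catC [:: y] [:: z]).
by rewrite /= !eqxx (negbTE nxz) (negbTE nxy) (negbTE nzy).
Qed.

Lemma contains_132 (w : seq nat) p q r :
  p < q -> q < r -> r < size w ->
  nth 0 w p < nth 0 w r -> nth 0 w r < nth 0 w q ->
  contains [:: 1; 3; 2] w.
Proof.
move=> pq qr rw xz zy; exists [seq nth 0 w i | i <- [:: p; q; r]].
split; last exact: red_132.
by apply: subseq_nth => /=; lia.
Qed.

Lemma not_all_precede (w : seq nat) y x :
  ~ all_precede w y x ->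
  exists p q, [/\ p < size w, q < size w, nth 0 w p = y, nth 0 w q = x
                & q <= p].
Proof.
case: (boolP [exists p : 'I_(size w), exists q : 'I_(size w),
  [&& nth 0 w p == y, nth 0 w q == x & q <= p]]).
  move=> /existsP[p /existsP[q /and3P[/eqP py /eqP qx qp]]] _.
  by exists p, q; split.
move=> none []; move=> p q pw qw py qx; rewrite ltnNge.
apply: contra none => qp.
apply/existsP; exists (Ordinal pw); apply/existsP; exists (Ordinal qw) => /=.
by rewrite py qx !eqxx.
Qed.

Definition orientation n (L : sgraph 'I_n) : rel 'I_n :=
  fun i j => adj L i j && (j < i).

Section Orientation.

Variables (n : nat) (L : sgraph 'I_n) (w : seq nat).
Hypothesis Lw : represents12 L w.

Lemma orientationP (i j : 'I_n) :
  orientation L i j <-> j < i /\ all_precede w i.+1 j.+1.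
Proof.
rewrite /orientation adj_sym; case: Lw => _ repL.
by split=> [/andP[ij ji]|[ji ij]]; [split|apply/andP; split] => //;
  apply/(repL j i ji).
Qed.

Lemma not_orientation (i j : 'I_n) :
  ~~ orientation L i j ->
  i <= j \/ exists p q, [/\ p < size w, q < size w, nth 0 w p = i.+1,
                            nth 0 w q = j.+1 & q <= p].
Proof.
move=> nij; case: (leqP i j) => [|ji]; [by left | right].
by apply: not_all_precede => ij; move/negP: nij; apply; apply/orientationP.
Qed.

(** The heart of the argument: some [b] before some [c] extends to a copy
    [b c d] of 132, because any occurrence of [d] comes after that [c]. *)
Lemma contains_132_of_crossing (b c d : 'I_n) p q :
  b < d -> d < c -> all_precede w c.+1 d.+1 ->
  p < size w -> q < size w -> nth 0 w p = c.+1 -> nth 0 w q = b.+1 ->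
  q <= p -> contains [:: 1; 3; 2] w.
Proof.
move=> bd dc cd pw qw pc qb qp.
have d_in : d.+1 \in w by case: Lw => -> _; rewrite ltn_ord.
have rw : index d.+1 w < size w by rewrite index_mem.
have rd := nth_index 0 d_in.
have neq_qp : q != p by apply/eqP => E; move: qb; rewrite E pc; lia.
have pr := cd _ _ pw rw pc rd.
apply: (contains_132 (p := q) (q := p) (r := index d.+1 w)) => //.
- by rewrite ltn_neqAle neq_qp.
- by rewrite qb rd.
- by rewrite pc rd.
Qed.

Lemma orientation_two_plus_two_free (a b c d : 'I_n) :
  avoids [:: 1; 3; 2] w ->
  orientation L a b -> orientation L c d ->
  orientation L a d || orientation L c b.
Proof.
move=> av /orientationP[ba ab] /orientationP[dc cd].
apply/norP => -[/not_orientation nad /not_orientation ncb].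
case: nad => [ad|[p [q [pw qw pa qd qp]]]];
  case: ncb => [cb|[p' [q' [pw' qw' pc qb qp']]]].
- lia.
- apply: av; apply: (contains_132_of_crossing _ dc cd pw' qw' pc qb qp').
  exact: leq_trans ba ad.
- apply: av; apply: (contains_132_of_crossing _ ba ab pw qw pa qd qp).
  exact: leq_trans dc cb.
- have := ab _ _ pw qw' pa qb; have := cd _ _ pw' qw pc qd; lia.
Qed.

End Orientation.

Theorem corollary37 (R : realType) (V : finType) (G : sgraph V) :
  representable12_avoiding [:: 1; 3; 2] G -> co_interval_graph R G.
Proof.
move=> [lab [L [w [lab_bij labE Lw av]]]].
apply: (@interval_graph_of_two_plus_two_free V
          (fun u v => orientation L (lab u) (lab v))).
- by move=> u; rewrite /orientation ltnn andbF.
- by move=> a b c d; apply: orientation_two_plus_two_free Lw _ _ _ _ av.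
move=> u v neq_uv; rewrite /= /compl_adj neq_uv /orientation /=.
have : lab u != lab v :> nat.
  by apply: contraNneq neq_uv => /val_inj /(bij_inj lab_bij) ->.
rewrite (adj_sym L (lab v)) labE neq_ltn.
by case: (adj G u v) => //= /orP[uv|vu]; rewrite ?uv ?vu ?andbF.
Qed.
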